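(* There is a constant $c>0$ such that for every $n\ge 2$ and every transitive binary relation $\preceq$ on a set $S$ with $|S|=n$, there is a data structure representing $T=(S,\preceq)$ that occupies at most $n^2/4 + c\,(n^2\lg\lg n)/\lg n$ bits and, given two (not necessarily distinct) elements $a,b\in S$, reports whether $a\preceq b$ in $O(1)$ time.
   Context: A binary relation $\preceq$ on $S$ is transitive if $a\preceq b$ and $b\preceq c$ imply $a\preceq c$; it need not be reflexive or antisymmetric. Here $\lg n=\lceil\log_2 n\rceil$. The model is the word-RAM with word size $\Theta(\lg n)$ bits; elements are identified by distinct integer labels in $\{1,\dots,n\}$; space is measured in bits.
   Formalization: At n = 2 the term lg lg n is 0, so the stated bound would be 1 bit although there are 13 transitive relations on a labelled 2-set; lg lg n is therefore replaced by max(1, lg lg n), which changes nothing for n ≥ 3. *)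

(* Defs.v *)
From mathcomp Require Import all_boot all_order all_algebra.

Set Implicit Arguments.
Unset Strict Implicit.
Unset Printing Implicit Defensive.

(* [up_log 2 n] is the least [e] with [n <= 2 ^ e], i.e. the ceiling of the
   binary logarithm of [n]. *)
Definition lg (n : nat) : nat := up_log 2 n.

(* The clamp only matters at [n = 2], where [lg (lg 2) = 0]: without it the
   space bound would be one bit there, while there are 13 transitive relations
   on a two-element set. *)
Definition lglg (n : nat) : nat := maxn 1 (lg (lg n)).

(* The unit-cost word-RAM.  A [w]-bit word is a natural number below [2 ^ w];
   registers and memory cells hold words, and memory is addressed by words.
   A program refers to registers by literal indices, hence uses only finitely
   many of them. *)

Inductive binop : Type :=
  | OAdd | OSub | OMul | ODiv | OMod | OAnd | OOr | OXor | OShl | OShr | OEq | OLt.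

Inductive instr : Type :=
  | IConst of nat & nat               (* IConst d k:    R[d] <- k            *)
  | IOp of binop & nat & nat & nat    (* IOp o d x y:   R[d] <- R[x] o R[y]  *)
  | IRead of nat & nat                (* IRead d x:     R[d] <- M[R[x]]      *)
  | IWrite of nat & nat               (* IWrite x y:    M[R[x]] <- R[y]      *)
  | IJump of nat                      (* IJump l:       goto l               *)
  | IJumpz of nat & nat               (* IJumpz x l:    if R[x] = 0 goto l   *)
  | IHalt of nat.                     (* IHalt x:       stop and output R[x] *)

Definition program : Type := seq instr.

Definition wrap (w v : nat) : nat := v %% 2 ^ w.

(* Division by zero yields 0 and remainder by zero the dividend, as in
   [divn] and [modn]; subtraction is modulo [2 ^ w]. *)
Definition eval_binop (w : nat) (o : binop) (x y : nat) : nat :=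
  wrap w
    match o with
    | OAdd => x + y
    | OSub => x + 2 ^ w - y
    | OMul => x * y
    | ODiv => x %/ y
    | OMod => x %% y
    | OAnd => Nat.land x y
    | OOr  => Nat.lor x y
    | OXor => Nat.lxor x y
    | OShl => x * 2 ^ y
    | OShr => x %/ 2 ^ y
    | OEq => x == y
    | OLt => x < y
    end.

Record state : Type := State {
  pc : nat;
  regs : nat -> nat;
  mem : nat -> nat
}.

Definition upd (f : nat -> nat) (k v : nat) : nat -> nat :=
  fun i => if i == k then v else f i.

Definition step (w : nat) (i : instr) (s : state) : state :=
  let: State l R M := s in
  match i with
  | IConst d k => State l.+1 (upd R d (wrap w k)) M
  | IOp o d x y => State l.+1 (upd R d (eval_binop w o (R x) (R y))) M
  | IRead d x => State l.+1 (upd R d (M (R x))) M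
  | IWrite x y => State l.+1 R (upd M (R x) (R y))
  | IJump l' => State l' R M
  | IJumpz x l' => State (if R x == 0 then l' else l.+1) R M
  | IHalt _ => s
  end.

(* [run w p t s = Some v] iff [p], started in [s], halts with output [v] after
   executing at most [t] instructions (the final [IHalt] included).  Running out
   of time or leaving the program text gives [None]. *)
Fixpoint run (w : nat) (p : program) (t : nat) (s : state) : option nat :=
  if t is t'.+1 then
    match onth p (pc s) with
    | None => None
    | Some (IHalt x) => Some (regs s x)
    | Some i => run w p t' (step w i s)
    end
  else None.

(* The words of [D] occupy the cells [0 .. size D - 1]; everything else is 0,
   except for the two arguments, in registers 0 and 1.  In particular neither
   [n] nor [w] is supplied: a program that needs them must find them in [D]. *)
Definition init_state (w : nat) (D : seq nat) (i j : nat) : state :=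
  State 0 (fun k => nth 0 [:: wrap w i; wrap w j] k) (fun k => nth 0 D k).

Definition query (w : nat) (p : program) (t : nat) (D : seq nat) (i j : nat) :
  option nat := run w p t (init_state w D i j).

Definition is_memory_image (w : nat) (D : seq nat) : bool :=
  all (fun v => v < 2 ^ w) D.

Definition space_in_bits (w : nat) (D : seq nat) : nat := w * size D.

Definition is_labelling (S : finType) (n : nat) (lab : S -> nat) : Prop :=
  injective lab /\ forall x : S, 1 <= lab x <= n.

(* [D], queried through [p], answers every question [r a b] within [t] steps;
   the outputs 1 and 0 stand for true and false. *)
Definition answers (w : nat) (p : program) (t : nat) (D : seq nat)
    (S : finType) (lab : S -> nat) (r : rel S) : Prop :=
  forall a b : S, query w p t D (lab a) (lab b) = Some (nat_of_bool (r a b)).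

(* Main.v *)
Require Import Defs.
From mathcomp Require Import all_boot all_order all_algebra.
From Stdlib Require PeanoNat.
From mathcomp Require Import zify ring.

Set Implicit Arguments.
Unset Strict Implicit.
Unset Printing Implicit Defensive.

(* Cut the strict part of the relation into about [(lg n) ^ 3] levels by the size
   of down-sets; pairs inside a level are few.  Look at the two top levels.  If
   they are sparsely related, merge them and declare the related pairs to be
   errors.  Otherwise, by the Kovari-Sos-Turan argument, they contain sets
   [A < B] of size [q = Theta (lg n / lglg n)] with all pairs related; remove
   them.  No remaining element lies strictly between the two levels, so by
   transitivity each one can record its relation to all [2 * q] removed elements
   in only [q + 2] bits, which adds up to [n ^ 2 / 4 + n ^ 2 / (2 * q)].  Mutually
   related pairs are recognised by a class identifier.  The answers that come
   out wrong are flipped by a matrix with [O (n ^ 2 / (lg n) ^ 3)] ones, stored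
   as blocks of [w * w] bits behind one pointer each, all zero blocks being
   shared. *)

(** * Bicliques in dense bipartite graphs *)

Section Biclique.
Variables (S : finType) (e : rel S).

Definition edges (X Y : {set S}) : nat :=
  \sum_(y in Y) #|[set x in X | e x y]|.

Lemma edgesC X Y : edges X Y = \sum_(x in X) #|[set y in Y | e x y]|.
Proof.
rewrite /edges.
under eq_bigr do rewrite -sum1dep_card big_mkcondr /=.
rewrite exchange_big /=.
by under [RHS]eq_bigr do rewrite -sum1dep_card big_mkcondr /=.
Qed.

Lemma edgesE X Y : edges X Y = #|[set p in setX X Y | e p.1 p.2]|.
Proof.
rewrite edgesC -sum1dep_card.
under eq_bigr do rewrite -sum1dep_card.
rewrite pair_big_dep /=; apply: eq_bigl => p.
by rewrite !inE andbA.
Qed.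

Lemma edges_le X Y : edges X Y <= #|X| * #|Y|.
Proof.
rewrite /edges mulnC -sum_nat_const leq_sum // => y _.
by apply: subset_leq_card; apply/subsetP => x; rewrite inE => /andP[].
Qed.

Lemma subset_of_card (Z : {set S}) k :
  k <= #|Z| -> exists2 A : {set S}, A \subset Z & #|A| = k.
Proof.
move=> kZ; have ut : uniq (take k (enum Z)) by rewrite take_uniq ?enum_uniq.
exists [set x in take k (enum Z)].
  by apply/subsetP => x; rewrite inE => /mem_take; rewrite mem_enum.
by rewrite cardsE (card_uniqP ut) size_takel // -cardE.
Qed.

Definition complete_between (A B : {set S}) : Prop :=
  forall x y, x \in A -> y \in B -> e x y.

(** [A] grows one vertex at a time while [B] shrinks to its common neighbours. By averaging, some
    new vertex keeps a fraction of at least [1 / (4 * L)] of [B]; the bound on [#|Y|] lets [q] such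
    losses leave [q] elements. *)
Lemma biclique_exists (X Y : {set S}) q L :
  #|X| * #|Y| < L * edges X Y ->
  4 * L * q <= #|X| -> 2 * L * (4 * L) ^ q * q <= #|Y| ->
  exists A B : {set S}, [/\ A \subset X, B \subset Y, #|A| = q, #|B| = q
    & complete_between A B].
Proof.
move=> dense Xbig Ybig.
have L_gt0 : 0 < L by lia.
pose deg y := #|[set x in X | e x y]|.
(* The average degree exceeds [#|X| / L]; [G] keeps the vertices reaching half of that value. *)
pose G := [set y in Y | #|X| <= 2 * L * deg y].
have Gbig : #|Y| < 2 * L * #|G|.
  have : 2 * L * edges X Y <= 2 * L * #|X| * #|G| + #|X| * #|Y|.
    rewrite /edges big_distrr /=.
    rewrite (bigID (fun y => #|X| <= 2 * L * deg y)) /=; apply: leq_add.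
      rewrite [leqRHS]mulnC -sum_nat_const.
      under [leqRHS]eq_bigl do rewrite inE.
      apply: leq_sum => y _; rewrite leq_mul2l; apply/orP; right.
      by apply: subset_leq_card; apply/subsetP => x; rewrite inE => /andP[].
    apply: (@leq_trans (\sum_(y in Y | ~~ (#|X| <= 2 * L * deg y)) #|X|)).
      by apply: leq_sum => y /andP[_]; rewrite -ltnNge => /ltnW.
    rewrite [leqRHS]mulnC -sum_nat_const [leqRHS](bigID (fun y => #|X| <= 2 * L * deg y)) /=.
    exact: leq_addl.
  have [->|X0] := posnP #|X|; nia.
have grow i : i <= q -> exists A B : {set S}, [/\ A \subset X, B \subset G,
    #|A| = i, #|G| <= #|B| * (4 * L) ^ i & complete_between A B].
  elim: i => [_|i IHi iq].
    exists set0, G; split; rewrite ?sub0set ?cards0 ?muln1 //.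
    by move=> x y; rewrite inE.
  have [A [B [AX BG cA Bbig AB]]] := IHi (ltnW iq).
  pose N x := [set y in B | e x y].
  have cXA : #|X :\: A| = #|X| - i by rewrite cardsD (setIidPr AX) cA.
  have [x xXA xN] : exists2 x, x \in X :\: A & #|B| <= 4 * L * #|N x|.
    apply/exists_inP; apply: contraT; rewrite negb_exists_in => /forall_inP none.
    (* The extra unit per vertex makes the summed inequality strict, hence contradictory to
       [low]. *)
    have up : \sum_(x in X :\: A) (4 * L * #|N x|).+1 <= #|X :\: A| * #|B|.
      rewrite -sum_nat_const; apply: leq_sum => x xXA.
      by rewrite ltnNge; apply: none.
    have low : #|B| * #|X| <= 4 * L * edges (X :\: A) B.
      rewrite -sum_nat_const /edges big_distrr /=; apply: leq_sum => y yB.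
      have := subsetP BG _ yB; rewrite inE => /andP[yY degy].
      (* Leaving out [A] costs [i < q] neighbours, at most half of the guaranteed
         [#|X| / (2 * L)]. *)
      have : deg y <= #|[set x in X :\: A | e x y]| + i.
        rewrite /deg -cA -(cardsID A [set x in X | e x y]) addnC leq_add //.
          apply: subset_leq_card; apply/subsetP => x; rewrite !inE.
          by move=> /andP[-> /andP[-> ->]].
        by rewrite subset_leq_card // subsetIr.
      by nia.
    have sumE : \sum_(x in X :\: A) (4 * L * #|N x|).+1
        = 4 * L * edges (X :\: A) B + #|X :\: A|.
      under eq_bigr do rewrite -addn1.
      by rewrite big_split /= -big_distrr /= edgesC sum1_card.
    by nia.
  exists (x |: A), (N x); move: xXA; rewrite inE => /andP[xA xX].
  split.
  - by rewrite subUset sub1set xX.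
  - by apply/subsetP => y; rewrite inE => /andP[/(subsetP BG)].
  - by rewrite cardsU1 xA cA.
  - by rewrite expnS; have := leq_mul xN (leqnn ((4 * L) ^ i)); lia.
  - move=> a y; rewrite !inE => /orP[/eqP->|aA] /andP[yB exy] //; exact: AB.
have [A [B [AX BG cA Bbig AB]]] := grow _ (leqnn q).
have [B' B'B cB'] : exists2 B' : {set S}, B' \subset B & #|B'| = q.
  apply: subset_of_card.
  have P0 : 0 < (4 * L) ^ q by rewrite expn_gt0; lia.
  rewrite -(leq_pmul2r P0); apply: leq_trans Bbig.
  have L20 : 0 < 2 * L by lia.
  rewrite -(leq_pmul2l L20); apply: leq_trans (ltnW Gbig).
  by apply: leq_trans Ybig; lia.
exists A, B'; split=> //.
  apply: subset_trans B'B (subset_trans BG _).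
  by apply/subsetP => y; rewrite inE => /andP[].
by move=> x y xA yB'; apply: AB => //; apply: (subsetP B'B).
Qed.

End Biclique.

(** * Peeling off bicliques *)

(* Elements are grouped by [idx]; every group but the last is a removed biclique,
   [side] telling its upper half from its lower one and [off] numbering each
   half.  The bits [cell v j] (0: low, 1: saturated, [o + 2]: relation to the
   elements with offset [o]) are what [v] records about the group [j < idx v]. *)
Record peeling (S : finType) : Type := Peeling {
  idx : S -> nat;
  off : S -> nat;
  side : S -> bool;
  cell : S -> nat -> nat -> bool
}.

Definition maj (a b c : bool) : bool := if a then b || c else b && c.

Section Peel.
Variable S : finType.
Implicit Types (P : peeling S) (e T : rel S) (l : S -> nat) (U : {set S}).

(** The element with the larger [idx] holds the record about the other one's group. The majority
    merges the cases of a low element: if saturated, it is below the whole upper half and the cell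
    decides the lower half; otherwise it is below nothing in the lower half and the cell decides the
    upper half. *)
Definition decode P : rel S := fun x y =>
  if idx P x < idx P y then
    [&& ~~ cell P y (idx P x) 0, ~~ side P x & cell P y (idx P x) (off P x).+2]
  else if idx P y < idx P x then
    cell P x (idx P y) 0 &&
      maj (cell P x (idx P y) 1) (side P y) (cell P x (idx P y) (off P y).+2)
  else false.

Definition disagreements P T U : {set S * S} :=
  [set p in setX U U | decode P p.1 p.2 != T p.1 p.2].

Definition level_lt e l : rel S := fun x y => e x y && (l x < l y).

(** The potential of the peeling: merging two levels [X] and [Y] releases [#|X| * #|Y|] pairs, which
    pay for the errors made. *)
Definition ordered_pairs l U : {set S * S} :=
  [set p in setX U U | l p.1 < l p.2].

Definition full_groups P U q : Prop :=
  forall v j, v \in U -> j < idx P v -> #|[set x in U | idx P x == j]| = 2 * q.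

Lemma level_lt_trans e l : transitive e -> transitive (level_lt e l).
Proof.
move=> te y x z /andP[xy lxy] /andP[yz lyz].
by rewrite /level_lt (te _ _ _ xy yz) (ltn_trans lxy lyz).
Qed.

Definition trivial_peeling : peeling S :=
  Peeling (fun=> 0) (fun=> 0) (fun=> false) (fun _ _ _ => false).

Section Add.
Variables (e : rel S) (l : S -> nat) (U A B : {set S}) (m q : nat).
Variable P : peeling S.
Hypotheses (te : transitive e) (lU : forall x, x \in U -> l x <= m.+1).
Hypotheses (lA : forall x, x \in A -> l x = m) (lB : forall x, x \in B -> l x = m.+1).
Hypothesis AB : complete_between e A B.
Hypotheses (AU : A \subset U) (BU : B \subset U) (cA : #|A| = q) (cB : #|B| = q).

Let T := level_lt e l.
Let K := A :|: B.

(* [low v] selects which of the two query directions can hold between [v] and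
   the biclique; a [v] lying below a member of [A] lies below all of [B]. *)
Let low v := l v <= m.
Let sat v := low v && [exists x in A, T v x].
Definition added_cell v j p : bool :=
  match j, p with
  | j'.+1, _ => cell P v j' p
  | 0, 0 => low v
  | 0, 1 => sat v
  | 0, o.+2 =>
    if low v then T v (nth v (enum (if sat v then A else B)) o)
    else T (nth v (enum A) o) v
  end.

Definition add_biclique : peeling S := Peeling
  (fun x => if x \in K then 0 else (idx P x).+1)
  (fun x => if x \in A then index x (enum A)
            else if x \in B then index x (enum B) else off P x)
  (fun x => if x \in K then x \in B else side P x)
  added_cell.

Lemma disjoint_AB x : x \in A -> x \in B -> false.
Proof. by move=> /lA lx /lB; rewrite lx => /eqP; rewrite ltn_eqF. Qed.

Lemma card_biclique : #|K| = 2 * q.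
Proof.
rewrite /K cardsU cA cB; suff -> : A :&: B = set0 by rewrite cards0 subn0 addnn mul2n.
by apply/setP => x; rewrite !inE; apply/andP => -[/disjoint_AB h /h].
Qed.

Lemma level_lt_top x y : x \in B -> y \in U -> T x y = false.
Proof. by move=> /lB lx /lU ly; rewrite /T /level_lt lx ltnNge ly andbF. Qed.

(** [A] and [B] lie in the two top levels. Hence an outside element of level at most [m] has nothing
    of [K] below it, while one of level [m.+1] has nothing of [K] above it and only members of [A]
    can be below it. Transitivity through a member of [A] settles the saturated case. *)
Lemma add_decodeK x y : x \in K -> y \in U -> y \notin K ->
  decode add_biclique x y = T x y /\ decode add_biclique y x = T y x.
Proof.
move=> xK yU yK; rewrite /decode /= xK (negbTE yK) /= -/T.
case lowy: (low y); rewrite /=.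
  have -> : T x y = false.
    apply/negbTE; rewrite /T /level_lt negb_and -leqNgt; apply/orP; right.
    by apply: leq_trans lowy _; move: xK; rewrite inE => /orP[/lA->|/lB->].
  split=> //; case saty: (sat y); rewrite /=.
    move: xK; rewrite inE => /orP[xA|xB].
      rewrite xA nth_index ?mem_enum //.
      by case xB: (x \in B) => //; case: (disjoint_AB xA xB).
    rewrite xB /=; move: saty => /andP[_ /exists_inP[a aA ya]].
    apply/esym; apply: (level_lt_trans te ya).
    by rewrite /level_lt AB // (lA aA) (lB xB) /=.
  case xA: (x \in A).
    case xB: (x \in B); first by case: (disjoint_AB xA xB).
    rewrite /=; apply/esym/negbTE; apply: contraFN saty => yx.
    by rewrite /sat lowy; apply/exists_inP; exists x.
  move: xK; rewrite inE xA /= => xB; rewrite xB nth_index ?mem_enum //.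
have ly : l y = m.+1.
  by apply/eqP; rewrite eqn_leq lU //= ltnNge; move: lowy; rewrite /low => ->.
split; last first.
  rewrite /T /level_lt ly; apply/esym/negbTE; rewrite negb_and -leqNgt.
  by apply/orP; right; move: xK; rewrite inE => /orP[/lA->|/lB->].
case xB: (x \in B); rewrite /=; first by rewrite level_lt_top.
move: xK; rewrite inE xB orbF => xA.
by rewrite xA nth_index ?mem_enum.
Qed.

Lemma add_decode_old x y : x \notin K -> y \notin K ->
  decode add_biclique x y = decode P x y.
Proof.
move=> xK yK; rewrite /decode /= (negbTE xK) (negbTE yK) !ltnS /=.
by move: xK yK; rewrite !inE !negb_or => /andP[/negbTE-> /negbTE->] /andP[/negbTE-> /negbTE->].
Qed.

(** Pairs with exactly one element in [K] are decoded correctly. Pairs inside [K] share the index 0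
    and are decoded as unrelated, so all [(2 * q) ^ 2] of them are charged. *)
Lemma add_disagreements :
  #|disagreements add_biclique T U| <= #|disagreements P T (U :\: K)| + (2 * q) ^ 2.
Proof.
have -> : (2 * q) ^ 2 = #|setX K K| by rewrite cardsX card_biclique mulnn.
apply: leq_trans (leq_card_setU _ _); apply: subset_leq_card.
apply/subsetP => -[x y]; rewrite !inE -!in_setU -/K /= => /andP[/andP[xU yU]].
rewrite xU yU; case xK: (x \in K); case yK: (y \in K) => //=.
- by rewrite (add_decodeK xK yU (negbT yK)).1 eqxx.
- by rewrite (add_decodeK yK xU (negbT xK)).2 eqxx.
- by rewrite add_decode_old ?xK ?yK // orbF.
Qed.

Lemma add_full_groups : full_groups P (U :\: K) q -> full_groups add_biclique U q.
Proof.
have KU : K \subset U by rewrite subUset AU.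
move=> fP v [|j] vU /=; case vK: (v \in K) => //.
  move=> _; rewrite -card_biclique; apply: eq_card => x; rewrite inE.
  case xK: (x \in K); last by rewrite andbF.
  by rewrite (subsetP KU _ xK).
rewrite ltnS => jv; rewrite -(fP v j) // ?inE ?vU -?in_setU -/K ?vK //.
apply: eq_card => x; rewrite !inE -!in_setU -/K; case xK: (x \in K) => //=.
by rewrite andbF.
Qed.

Lemma add_off : 0 < q -> (forall x, off P x < q) -> forall x, off add_biclique x < q.
Proof.
move=> q0 oP x /=; case xA: (x \in A).
  by rewrite -cA cardE index_mem mem_enum.
by case xB: (x \in B) => //; rewrite -cB cardE index_mem mem_enum.
Qed.

End Add.

Variables (e : rel S) (q L : nat).
Hypotheses (te : transitive e) (q0 : 0 < q) (L0 : 0 < L).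
(** If one of two levels is too small for [biclique_exists], at most [thr] pairs join them. *)
Let thr := #|S| * (4 * L * q + 2 * L * (4 * L) ^ q * q).

(** Each step either merges the two top levels, lowering [m], or removes a biclique, shrinking [U].
    A merge is paid by the lost ordered pairs plus [thr], and occurs at most [m] times. A biclique
    costs [(2 * q) ^ 2] pairs, that is [2 * q] for each removed element. *)
Lemma peel m l U : (forall x, x \in U -> l x <= m) ->
  exists P, [/\ forall x, off P x < q, full_groups P U q &
    L * #|disagreements P (level_lt e l) U| <=
      #|ordered_pairs l U| + L * (m * thr + 2 * q * #|U|)].
Proof.
have [k] := ubnP (#|U| + m); elim: k m l U => // k IHk [|m] l U Uk lU.
  exists trivial_peeling; split=> //.
  suff -> : disagreements trivial_peeling (level_lt e l) U = set0.
    by rewrite cards0 muln0.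
  apply/setP => -[x y]; rewrite !inE /decode /= /level_lt.
  apply/andP => -[/andP[/lU lx /lU ly]]; move: lx ly.
  by rewrite !leqn0 => /eqP-> /eqP->; rewrite andbF.
pose X := [set x in U | l x == m]; pose Y := [set x in U | l x == m.+1].
have [sparse|dense] := leqP (L * edges e X Y) (#|X| * #|Y| + L * thr).
  (* The merged levels forget only the pairs from [X] to [Y]. *)
  pose l' x := minn (l x) m.
  have [|x xU|P [oP fP dP]] := IHk m l' U; first by lia.
    by rewrite geq_minr.
  exists P; split=> //.
  have XYl p : p.1 \in U -> p.2 \in U -> l p.1 < l p.2 -> ~~ (l' p.1 < l' p.2) ->
      (p.1 \in X) && (p.2 \in Y).
    by move=> p1 p2; have := lU _ p1; have := lU _ p2; rewrite !inE p1 p2 /= /l'; lia.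
  have ldis : #|disagreements P (level_lt e l) U| <=
      #|disagreements P (level_lt e l') U| + edges e X Y.
    rewrite edgesE.
    apply: leq_trans (leq_card_setU _ _); apply: subset_leq_card.
    apply/subsetP => p; rewrite in_setU !inE => /andP[/andP[p1 p2]].
    rewrite p1 p2 /= /level_lt.
    have XY := XYl p p1 p2.
    have ll' : l' p.1 < l' p.2 -> l p.1 < l p.2 by rewrite /l'; lia.
    have [l'p|l'p] := boolP (l' p.1 < l' p.2); first by rewrite ll' // => ->.
    have [lp|lp] := boolP (l p.1 < l p.2); rewrite ?andbF ?andbT; last by move=> ->.
    have := XY lp l'p; rewrite !inE p1 p2 /= => -> /=.
    by case: (e _ _); rewrite ?orbT // orbF.
  have ord : #|ordered_pairs l' U| + #|X| * #|Y| <= #|ordered_pairs l U|.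
    rewrite -cardsX -cardsUI; set I := _ :&: _.
    have -> : I = set0.
      apply/setP => p; rewrite !inE /l'; apply/negP.
      by move=> /andP[/andP[_ lt] /andP[/andP[_ /eqP lx] /andP[_ /eqP ly]]]; lia.
    rewrite cards0 addn0; apply: subset_leq_card; apply/subsetP => p.
    rewrite !inE /l' => /orP[/andP[-> lt]|/andP[/andP[-> /eqP->] /andP[-> /eqP->]]] /=; lia.
  by nia.
have [eX eY] : 4 * L * q <= #|X| /\ 2 * L * (4 * L) ^ q * q <= #|Y|.
  have thrXY : thr < #|X| * #|Y|.
    apply: leq_trans (edges_le e X Y); rewrite -(ltn_pmul2l L0); lia.
  have Xn := max_card (mem X); have Yn := max_card (mem Y).
  split; rewrite leqNgt; apply/negP => small; move: thrXY; apply/negP; rewrite -leqNgt.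
    by rewrite mulnC leq_mul //; lia.
  by rewrite leq_mul //; lia.
have dXY : #|X| * #|Y| < L * edges e X Y by lia.
have [A [B [AX BY cA cB AB]]] := biclique_exists dXY eX eY.
have AU x : x \in A -> (x \in U) * (l x = m).
  by move=> /(subsetP AX); rewrite inE => /andP[-> /eqP].
have BU x : x \in B -> (x \in U) * (l x = m.+1).
  by move=> /(subsetP BY); rewrite inE => /andP[-> /eqP].
have lA x (xA : x \in A) := (AU x xA).2; have lB x (xB : x \in B) := (BU x xB).2.
have {}AU : A \subset U by apply/subsetP => x /AU[].
have {}BU : B \subset U by apply/subsetP => x /BU[].
have cK := card_biclique lA lB cA cB.
have KU : A :|: B \subset U by rewrite subUset AU.
have cUK : #|U| = #|U :\: (A :|: B)| + 2 * q.
  by rewrite -cK addnC -(cardsID (A :|: B) U) (setIidPr KU).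
have [|x|P [oP fP dP]] := IHk m.+1 l (U :\: (A :|: B)); first by lia.
  by rewrite inE => /andP[_ /lU].
exists (add_biclique e l A B m P); split.
- exact: add_off.
- exact: add_full_groups.
- have := add_disagreements P te lU lA lB AB cA cB.
  have : #|ordered_pairs l (U :\: (A :|: B))| <= #|ordered_pairs l U|.
    apply: subset_leq_card; apply/subsetP => p; rewrite !inE.
    by move=> /andP[/andP[/andP[_ ->] /andP[_ ->]]].
  rewrite cUK; move: dP; set d1 := #|_|; set d2 := #|_|; set d3 := #|_|; set d4 := #|_|.
  rewrite -mulnn; nia.
Qed.

End Peel.

(** * Transitive relations *)

Section Height.
Variables (S : finType) (e : rel S).
Hypotheses (te : transitive e) (ie : irreflexive e).

Definition height (x : S) : nat := #|[set z | e z x]|.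

Lemma height_lt x y : e x y -> height x < height y.
Proof.
move=> xy; apply: proper_card; apply/properP; split.
  by apply/subsetP => z; rewrite !inE => zx; apply: te zx xy.
by exists x; rewrite !inE ?ie.
Qed.

(* The elements below a lowest such [x] are all below [y] and are not counted. *)
Lemma same_slice_card t y : 0 < t ->
  #|[set x | e x y && (height x %/ t == height y %/ t)]| <= t.
Proof.
move=> t0; set Z := [set x | _].
have [->|[x1 x1Z]] := set_0Vmem Z; first by rewrite cards0.
have [x0 x0Z min] := arg_minnP height x1Z.
have {}x0Z : x0 \in Z := x0Z.
have x0y : e x0 y by move: x0Z; rewrite inE => /andP[].
have sl : height x0 %/ t = height y %/ t by move: x0Z; rewrite inE => /andP[_ /eqP].
have : #|Z| + height x0 <= height y.
  rewrite /height -cardsUI; set I := _ :&: _.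
  have -> : I = set0.
    apply/setP => z; rewrite in_setI in_set0; apply/negP => /andP[/min].
    by rewrite leqNgt inE => /negP h /height_lt.
  rewrite cards0 addn0; apply: subset_leq_card; apply/subsetP => z.
  rewrite !inE => /orP[/andP[]//|zx]; exact: te zx x0y.
have := divn_eq (height x0) t; have := divn_eq (height y) t; have := ltn_pmod (height y) t0.
by rewrite sl; lia.
Qed.

End Height.

(* Each group below [idx v] has [2 * q] members, so the left side counts at most
   the pairs of elements in distinct groups, once for every unordered pair. *)
Lemma sum_idx (S : finType) (P : peeling S) q : full_groups P setT q ->
  4 * q * (\sum_x idx P x) <= #|S| ^ 2.
Proof.
move=> fP.
have bnd v : 2 * q * idx P v <= \sum_x (idx P x < idx P v).
  have -> : \sum_x (idx P x < idx P v) = \sum_(j < idx P v) \sum_x (idx P x == j).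
    rewrite exchange_big /=; apply: eq_bigr => x _.
    have [xv|xv] := ltnP (idx P x) (idx P v).
      rewrite (bigD1 (Ordinal xv)) //= eqxx big1 // => j; rewrite -val_eqE /= eq_sym.
      by move=> /negbTE->.
    by rewrite big1 // => j _; case: eqP => // xj; have := ltn_ord j; lia.
  rewrite mulnC -[X in X * _]card_ord -sum_nat_const; apply: leq_sum => j _.
  rewrite -(fP v j) ?inE // -sum1dep_card big_mkcond /=.
  by apply: leq_sum => x _; rewrite !inE; case: (_ == _).
have sym : (\sum_v \sum_x (idx P x < idx P v)) * 2 <= #|S| ^ 2.
  rewrite muln2 -addnn {2}exchange_big -big_split /=.
  rewrite -mulnn -sum_nat_const; apply: leq_sum => v _.
  rewrite -big_split /= -sum1_card; apply: leq_sum => x _.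
  by case: ltngtP.
apply: leq_trans sym; rewrite muln2 -addnn.
have : 2 * q * \sum_v idx P v <= \sum_v \sum_x (idx P x < idx P v).
  by rewrite big_distrr /=; apply: leq_sum.
lia.
Qed.

Section Transitive.
Variables (S : finType) (r : rel S).
Hypothesis tr : transitive r.

(** Equality is added to obtain an equivalence even where [r] is not reflexive; the missing loops
    become errors. *)
Definition mutual : rel S := fun x y => (x == y) || r x y && r y x.
Definition strict_part : rel S := fun x y => r x y && ~~ r y x.
Definition class_rep (x : S) : S := odflt x [pick z | mutual x z].

Lemma mutual_refl x : mutual x x. Proof. by rewrite /mutual eqxx. Qed.

Lemma mutual_sym : symmetric mutual.
Proof. by move=> x y; rewrite /mutual eq_sym andbC. Qed.

Lemma mutual_trans : transitive mutual.
Proof.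
move=> y x z /orP[/eqP->//|/andP[xy yx]] /orP[/eqP<-|/andP[yz zy]].
  by rewrite /mutual xy yx orbT.
by rewrite /mutual (tr xy yz) (tr zy yx) orbT.
Qed.

(** Mutually related elements define the same predicate, and [pick] depends on the predicate only
    extensionally. *)
Lemma class_repE x y : (class_rep x == class_rep y) = mutual x y.
Proof.
have rep z : mutual z (class_rep z).
  by rewrite /class_rep; case: pickP => //= _; apply: mutual_refl.
apply/eqP/idP => [xy|xy].
  by apply: mutual_trans (rep x) _; rewrite xy mutual_sym.
have eqm z : mutual x z = mutual y z.
  apply/idP/idP; apply: mutual_trans; last by [].
  by rewrite mutual_sym.
rewrite /class_rep (eq_pick eqm); case: pickP => // /(_ y).
by rewrite mutual_refl.
Qed.

Lemma strict_part_trans : transitive strict_part.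
Proof.
move=> y x z /andP[xy nyx] /andP[yz _]; rewrite /strict_part (tr xy yz) /=.
by apply: contra nyx => zx; apply: tr yz zx.
Qed.

Lemma strict_part_irr : irreflexive strict_part.
Proof. by move=> x; rewrite /strict_part andbN. Qed.

Definition errors (P : peeling S) : {set S * S} :=
  [set p | ((class_rep p.1 == class_rep p.2) || decode P p.1 p.2) != r p.1 p.2].

(** Levels are slices of [t] consecutive heights, so there are few of them and [same_slice_card]
    bounds what they hide. In the last summand [2 * q] stands for the bicliques, [t] for the slices
    and 1 for the loops. *)
Lemma transitive_peeling q L t : 0 < q -> 0 < L -> 0 < t ->
  exists P, [/\ forall x, off P x < q, full_groups P setT q &
    L * #|errors P| <= #|S| ^ 2 + L * (#|S| %/ t *
      (#|S| * (4 * L * q + 2 * L * (4 * L) ^ q * q)) + #|S| * (2 * q + t + 1))].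
Proof.
move=> q0 L0 t0.
pose l x := height strict_part x %/ t.
have lm x : x \in [set: S] -> l x <= #|S| %/ t.
  by move=> _; rewrite leq_div2r // max_card.
have [P [oP fP dP]] := peel strict_part_trans q0 L0 lm.
exists P; split=> //.
(* An error that is not a disagreement of [P] is a loop or a strict pair inside one level. *)
pose D := [set p : S * S | p.1 == p.2].
pose Z := [set p : S * S | strict_part p.1 p.2 && (l p.1 == l p.2)].
have cD : #|D| <= #|S|.
  apply: leq_trans (leq_imset_card (fun x => (x, x)) (mem S)).
  by apply/subset_leq_card/subsetP => -[x y]; rewrite inE /= => /eqP->; apply: imset_f.
have cZ : #|Z| <= #|S| * t.
  have -> : #|Z| = \sum_y #|[set x | strict_part x y && (l x == l y)]|.
    rewrite -sum1dep_card (eq_bigr (fun y => \sum_(x | strict_part x y && (l x == l y)) 1)).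
      rewrite (exchange_big_dep predT) //= pair_big_dep; exact: eq_bigl.
    by move=> y _; rewrite -sum1dep_card.
  rewrite -sum_nat_const; apply: leq_sum => y _; apply: same_slice_card => //.
    exact: strict_part_trans.
  exact: strict_part_irr.
have cE : #|errors P| <= #|disagreements P (level_lt strict_part l) setT| + (#|S| * t + #|S|).
  apply: leq_trans (leq_add (leqnn _) (leq_add cZ cD)).
  apply: leq_trans (leq_add (leqnn _) (leq_card_setU _ _)).
  apply: leq_trans (leq_card_setU _ _); apply: subset_leq_card; apply/subsetP => -[x y].
  rewrite !inE /= class_repE.
  case xy: (x == y); first by rewrite !orbT.
  rewrite /mutual xy /=; case rxy: (r x y); case ryx: (r y x) => //=;
    rewrite /level_lt /strict_part rxy ryx ?orbF //=.
  have [llt|llt] := boolP (l x < l y); first by move=> ->.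
  move=> _; apply/orP; right.
  have : height strict_part x < height strict_part y.
    apply: height_lt; [exact: strict_part_trans|exact: strict_part_irr|].
    by rewrite /strict_part rxy ryx.
  by rewrite eqn_leq [l y <= _]leqNgt llt andbT /l => /ltnW h; rewrite leq_div2r.
have oS : #|ordered_pairs l [set: S]| <= #|S| ^ 2.
  by apply: leq_trans (max_card _) _; rewrite card_prod mulnn.
rewrite cardsT in dP.
apply: leq_trans (leq_mul (leqnn L) cE) _; rewrite mulnDr.
by move: dP oS; set X := L * #|_|; lia.
Qed.

End Transitive.

(** * Straight-line programs and the query *)

Inductive expr : Type :=
  | EArg of nat
  | EConst of nat
  | EOp of binop & expr & expr
  | ERead of expr.

(* The copy [R[d] <- R[i]] is expressed as a bitwise or of a register with itself. *)
Fixpoint compile (d : nat) (e : expr) : program :=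
  match e with
  | EArg i => [:: IOp OOr d i i]
  | EConst k => [:: IConst d k]
  | EOp o e1 e2 => compile d e1 ++ compile d.+1 e2 ++ [:: IOp o d d d.+1]
  | ERead e1 => compile d e1 ++ [:: IRead d d]
  end.

Fixpoint eval (w : nat) (M R : nat -> nat) (e : expr) : nat :=
  match e with
  | EArg i => eval_binop w OOr (R i) (R i)
  | EConst k => Defs.wrap w k
  | EOp o e1 e2 => eval_binop w o (eval w M R e1) (eval w M R e2)
  | ERead e1 => M (eval w M R e1)
  end.

Fixpoint arity (e : expr) : nat :=
  match e with
  | EArg i => i.+1
  | EConst _ => 0
  | EOp _ e1 e2 => maxn (arity e1) (arity e2)
  | ERead e1 => arity e1
  end.

Lemma onth_cat_size T (s1 s2 : seq T) x : onth (s1 ++ x :: s2) (size s1) = Some x.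
Proof. by elim: s1. Qed.

Lemma eval_ext w M R R' e : (forall i, i < arity e -> R i = R' i) ->
  eval w M R e = eval w M R' e.
Proof.
elim: e => //= [i|o e1 IH1 e2 IH2|e1 IH1] h; first by rewrite h.
  by rewrite IH1 ?IH2 // => i hi; apply: h; rewrite leq_max hi ?orbT.
by rewrite IH1.
Qed.

(** Keeping the registers below [d] intact protects the arguments, and also a first operand while
    the second is computed from [d.+1] on. *)
Lemma run_compile w M e : forall pre post d R t, arity e <= d ->
  exists R', [/\ R' d = eval w M R e, forall i, i < d -> R' i = R i &
    run w (pre ++ compile d e ++ post) (size (compile d e) + t) (State (size pre) R M)
    = run w (pre ++ compile d e ++ post) t (State (size pre + size (compile d e)) R' M)].
Proof.
elim: e => [i|k|o e1 IH1 e2 IH2|e1 IH1] pre post d R t /= ad.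
- exists (upd R d (eval_binop w OOr (R i) (R i))); split.
  + by rewrite /upd eqxx.
  + by move=> j jd; rewrite /upd ltn_eqF.
  + by rewrite /= onth_cat_size addn1.
- exists (upd R d (Defs.wrap w k)); split.
  + by rewrite /upd eqxx.
  + by move=> j jd; rewrite /upd ltn_eqF.
  + by rewrite /= onth_cat_size addn1.
- have [ad1 ad2] : arity e1 <= d /\ arity e2 <= d by lia.
  set c1 := compile d e1; set c2 := compile d.+1 e2; set ins := IOp o _ _ _.
  (* The fuel left after [c1] must pay for [c2], the operation itself and the remaining [t]
     steps. *)
  have [R1 [R1d R1lt run1]] := IH1 pre (c2 ++ [:: ins] ++ post) d R (size c2 + t.+1) ad1.
  have [R2 [R2d R2lt run2]] :=
    IH2 (pre ++ c1) ([:: ins] ++ post) d.+1 R1 t.+1 (leqW ad2).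
  exists (upd R2 d (eval_binop w o (R2 d) (R2 d.+1))); split.
  + rewrite /upd eqxx R2lt // R1d R2d; congr eval_binop.
    by apply: eval_ext => i ie; apply: R1lt; apply: leq_trans ad2.
  + by move=> j jd; rewrite /upd ltn_eqF // R2lt ?R1lt // ltnW.
  + rewrite !size_cat /= -/c1 -/c2; move: run1 run2; rewrite !size_cat -/c1 -/c2.
    rewrite -!catA /= => run1 run2.
    have -> : size c1 + (size c2 + 1) + t = size c1 + (size c2 + t.+1) by lia.
    rewrite run1 run2 /=.
    have -> : pre ++ c1 ++ c2 ++ ins :: post = (pre ++ c1 ++ c2) ++ ins :: post.
      by rewrite -!catA.
    have -> : size pre + size c1 + size c2 = size (pre ++ c1 ++ c2).
      by rewrite !size_cat addnA.
    rewrite onth_cat_size /=; congr (run _ _ _ (State _ _ _)).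
    by rewrite !size_cat; lia.
- set c1 := compile d e1.
  have [R1 [R1d R1lt run1]] := IH1 pre ([:: IRead d d] ++ post) d R t.+1 ad.
  exists (upd R1 d (M (R1 d))); split.
  + by rewrite /upd eqxx R1d.
  + by move=> j jd; rewrite /upd ltn_eqF // R1lt.
  + rewrite size_cat /= -/c1; move: run1; rewrite -/c1 -!catA /= => run1.
    have -> : size c1 + 1 + t = size c1 + t.+1 by lia.
    rewrite run1 /=.
    have -> : pre ++ c1 ++ IRead d d :: post = (pre ++ c1) ++ IRead d d :: post.
      by rewrite -!catA.
    have -> : size pre + size c1 = size (pre ++ c1) by rewrite size_cat.
    rewrite onth_cat_size /=; congr (run _ _ _ (State _ _ _)).
    by rewrite !size_cat; lia.
Qed.

(** Registers 0 and 1 hold the arguments, so 2 is the first free one. The running time depends on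
    the expression alone, whence constant query time. *)
Definition expr_program (e : expr) : program := compile 2 e ++ [:: IHalt 2].
Definition expr_time (e : expr) : nat := (size (compile 2 e)).+1.

Lemma query_expr w e D i j : arity e <= 2 ->
  query w (expr_program e) (expr_time e) D i j =
  Some (eval w (fun k => nth 0 D k) (fun k => nth 0 [:: Defs.wrap w i; Defs.wrap w j] k) e).
Proof.
move=> ae; rewrite /query /init_state /expr_time -addn1.
have [R' [R'2 _ run1]] := @run_compile w (fun k => nth 0 D k) e [::] [:: IHalt 2] 2
  (fun k => nth 0 [:: Defs.wrap w i; Defs.wrap w j] k) 1 ae.
rewrite /expr_program /= in run1 *; rewrite run1 /= onth_cat_size.
by rewrite R'2.
Qed.

(* The query as an expression *)
Declare Scope expr_scope.
Delimit Scope expr_scope with expr.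
Local Notation "x + y" := (EOp OAdd x y) : expr_scope.
Local Notation "x * y" := (EOp OMul x y) : expr_scope.
Local Notation "x %/ y" := (EOp ODiv x y) : expr_scope.
Local Notation "x %% y" := (EOp OMod x y) : expr_scope.
Local Notation "x < y" := (EOp OLt x y) : expr_scope.
Local Notation "x == y" := (EOp OEq x y) : expr_scope.
Local Notation "x || y" := (EOp OOr x y) : expr_scope.
Local Notation "x >> y" := (EOp OShr x y) (at level 40) : expr_scope.
Local Notation "x ^^ y" := (EOp OXor x y) (at level 50) : expr_scope.
Local Notation "# k" := (EConst k) (at level 8, format "# k") : expr_scope.
Local Notation "M[ x ]" := (ERead x) : expr_scope.

Section Expressions.
Local Open Scope expr_scope.

(** Memory starts with a header of four words: word size, cell width [q.+2], stride [n.+1], address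
    of the block table. Five words per label follow: class, [idx], [side], [off], address of the bit
    row. *)
Definition e_w := M[ #0 ].
Definition e_width := M[ #1 ].
Definition e_stride := M[ #2 ].
Definition e_table := M[ #3 ].
Definition e_field k a := M[ a * #5 + #(4 + k)%N ].
Definition e_bit p i := (M[ p + i %/ e_w ] >> (i %% e_w)) %% #2.
Definition e_cell v x k := e_bit (e_field 4 v) (e_field 1 x * e_width + k).
(* Comparing sums of bits: [c + s < b] says that [b] holds while [c] and [s]
   fail, and the majority of three bits is half their sum. *)
Definition e_above x v :=
  (e_field 1 x < e_field 1 v) *
  (e_cell v x #0 + e_field 2 x < e_cell v x (e_field 3 x + #2)).
Definition e_below x v :=
  (e_field 1 x < e_field 1 v) *
  ((e_cell v x #0 *
    (e_cell v x #1 + e_field 2 x + e_cell v x (e_field 3 x + #2))) %/ #2).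
Definition e_code a b := a * e_stride + b.
(** The table has one pointer per [w * w] codes; the pointer leads to [w] words, one bit per
    code. *)
Definition e_exception c :=
  e_bit M[ e_table + c %/ (e_w * e_w) ] (c %% (e_w * e_w)).
Definition e_answer a b :=
  ((e_field 0 a == e_field 0 b) || (e_above a b || e_below b a))
    ^^ e_exception (e_code a b).
Definition e_query := e_answer (EArg 0) (EArg 1).

End Expressions.

(** * Evaluation without overflow *)

Section Eval.
Variables (w : nat) (M R : nat -> nat).
Let ev := eval w M R.
Local Notation B := (2 ^ w).

Lemma wrap_small v : v < B -> Defs.wrap w v = v.
Proof. exact: modn_small. Qed.

Lemma evC k : k < B -> ev (EConst k) = k.
Proof. exact: wrap_small. Qed.

Lemma evA i : R i < B -> ev (EArg i) = R i.
Proof. by move=> h; rewrite /ev /= /eval_binop PeanoNat.Nat.lor_diag wrap_small. Qed.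

Lemma evR e x : ev e = x -> ev (ERead e) = M x.
Proof. by rewrite /ev /= => ->. Qed.

Variables (e f : expr) (x y : nat).
Hypotheses (ex : ev e = x) (fy : ev f = y).

Lemma evD : x + y < B -> ev (e + f)%expr = x + y.
Proof. by move=> h; rewrite /ev /= -!/(ev _) ex fy /eval_binop wrap_small. Qed.

Lemma evM : x * y < B -> ev (e * f)%expr = x * y.
Proof. by move=> h; rewrite /ev /= -!/(ev _) ex fy /eval_binop wrap_small. Qed.

(** No bound on [y]: a false guard masks whatever a meaningless read returns. *)
Lemma evM0 : x = 0 -> ev (e * f)%expr = 0.
Proof. by move=> x0; rewrite /ev /= -!/(ev _) ex fy /eval_binop x0 mul0n /Defs.wrap mod0n. Qed.

Lemma evdiv : x < B -> ev (e %/ f)%expr = x %/ y.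
Proof.
move=> h; rewrite /ev /= -!/(ev _) ex fy /eval_binop wrap_small //.
exact: leq_ltn_trans (leq_div _ _) h.
Qed.

Lemma evmod : x < B -> ev (e %% f)%expr = x %% y.
Proof.
move=> h; rewrite /ev /= -!/(ev _) ex fy /eval_binop wrap_small //.
exact: leq_ltn_trans (leq_mod _ _) h.
Qed.

Lemma evshr : x < B -> ev (e >> f)%expr = x %/ 2 ^ y.
Proof.
move=> h; rewrite /ev /= -!/(ev _) ex fy /eval_binop wrap_small //.
exact: leq_ltn_trans (leq_div _ _) h.
Qed.

Hypothesis w0 : 0 < w.

Lemma bool_lt_word (b : bool) : b < B.
Proof. by apply: leq_ltn_trans (leq_b1 b) _; have : 2 ^ 0 < B by rewrite ltn_exp2l. Qed.

Lemma evlt : ev (e < f)%expr = (x < y).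
Proof. by rewrite /ev /= -!/(ev _) ex fy /eval_binop wrap_small ?bool_lt_word. Qed.

Lemma eveq : ev (e == f)%expr = (x == y).
Proof. by rewrite /ev /= -!/(ev _) ex fy /eval_binop wrap_small ?bool_lt_word. Qed.

End Eval.

Section EvalBool.
Variables (w : nat) (M R : nat -> nat) (e f : expr) (x y : bool).
Hypotheses (w0 : 0 < w) (ex : eval w M R e = x) (fy : eval w M R f = y).

Lemma evor : eval w M R (e || f)%expr = (x || y).
Proof.
rewrite /= ex fy /eval_binop (_ : Nat.lor x y = (x || y)) ?wrap_small ?bool_lt_word //.
by case: (x); case: (y).
Qed.

Lemma evxor : eval w M R (e ^^ f)%expr = (x (+) y).
Proof.
rewrite /= ex fy /eval_binop (_ : Nat.lxor x y = (x (+) y)) ?wrap_small ?bool_lt_word //.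
by case: (x); case: (y).
Qed.

End EvalBool.

(** * Correctness of the query over any memory with the required contents *)

Section Query.
Variables (S : finType) (lab : S -> nat) (r : rel S) (P : peeling S) (cls : S -> nat).
Variables (w n q table : nat) (row : S -> nat) (ptr : nat -> nat) (M : nat -> nat).
Local Notation B := (2 ^ w).

Definition bit_at p i := (M (p + i %/ w) %/ 2 ^ (i %% w)) %% 2.
Definition code x y := lab x * n.+1 + lab y.
Definition error x y := ((cls x == cls y) || decode P x y) (+) r x y.

Definition field x k := nth 0 [:: cls x; idx P x; nat_of_bool (side P x); off P x; row x] k.

Hypotheses (w2 : 2 < w) (ww : w * w < B) (M_lt : forall k, M k < B).
Hypotheses (n_lt : n * 5 + 9 < B) (nn_lt : n.+1 * n.+1 < B).
Hypotheses (lab_le : forall x, lab x <= n) (off_lt : forall x, off P x < q).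
Hypothesis width_lt : forall x, (idx P x).+1 * q.+2 < B.
Hypotheses (M0 : M 0 = w) (M1 : M 1 = q.+2) (M2 : M 2 = n.+1) (M3 : M 3 = table).
Hypothesis Mfield : forall x k, k < 5 -> M (lab x * 5 + (4 + k)) = field x k.
Hypothesis row_lt : forall v, row v + (idx P v * q.+2) %/ w < B.
Hypothesis row_bit : forall v j k, j < idx P v -> k < q.+2 ->
  bit_at (row v) (j * q.+2 + k) = cell P v j k.
Hypothesis table_lt : forall x y, table + code x y %/ (w * w) < B.
Hypothesis Mtable : forall x y, M (table + code x y %/ (w * w)) = ptr (code x y %/ (w * w)).
Hypothesis ptr_lt : forall x y, ptr (code x y %/ (w * w)) + w < B.
Hypothesis error_bit : forall x y,
  bit_at (ptr (code x y %/ (w * w))) (code x y %% (w * w)) = error x y.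

Variable R : nat -> nat.
Local Notation ev := (eval w M R).

Let word10 : 10 <= B. Proof. lia. Qed.
Let w_gt0 : 0 < w. Proof. lia. Qed.

Let ev_w : ev e_w = w. Proof. by rewrite -M0; apply: evR; apply: evC; lia. Qed.
Let ev_width : ev e_width = q.+2.
Proof. by rewrite -M1; apply: evR; apply: evC; lia. Qed.
Let ev_stride : ev e_stride = n.+1.
Proof. by rewrite -M2; apply: evR; apply: evC; lia. Qed.
Let ev_table : ev e_table = table.
Proof. by rewrite -M3; apply: evR; apply: evC; lia. Qed.

Lemma ev_field k e x : k < 5 -> ev e = lab x -> ev (e_field k e) = field x k.
Proof.
move=> k5 ex; have lx := lab_le x; rewrite -Mfield //; apply: evR.
by apply: evD; [apply: evM => //; [apply: evC|] |apply: evC|]; lia.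
Qed.

Lemma ev_bit e f p i : ev e = p -> ev f = i -> i < B -> p + i %/ w < B ->
  ev (e_bit e f) = bit_at p i.
Proof.
move=> ep fi iB pB; apply: evmod; last 2 first.
- by apply: evC; lia.
- by apply: leq_ltn_trans (leq_div _ _) (M_lt _).
apply: evshr => //.
  by apply: evR; apply: evD => //; apply: evdiv.
exact: evmod.
Qed.

Lemma ev_cell e f g v x k : idx P x < idx P v -> k < q.+2 ->
  ev e = lab v -> ev f = lab x -> ev g = k ->
  ev (e_cell e f g) = cell P v (idx P x) k.
Proof.
move=> xv kq ev_ fx gk; rewrite -row_bit //; have wv := width_lt v; have rv := row_lt v.
have lt : idx P x * q.+2 + k < idx P v * q.+2.
  by apply: (@leq_trans ((idx P x).+1 * q.+2)); [lia | rewrite leq_mul].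
apply: ev_bit.
- exact: (@ev_field 4).
- by apply: evD => //; [apply: evM => //; [exact: (@ev_field 1)|lia]|lia].
- lia.
- by apply: leq_ltn_trans rv; rewrite leq_add2l leq_div2r // ltnW.
Qed.

Let ev_off f x : ev f = lab x -> ev (e_field 3 f + #2)%expr = (off P x).+2.
Proof.
move=> fx; rewrite -[RHS]addn2; apply: evD; first exact: (@ev_field 3).
  by apply: evC; lia.
by have := off_lt x; have := width_lt x; lia.
Qed.

Lemma ev_above e f x v : ev e = lab x -> ev f = lab v ->
  ev (e_above e f) = (idx P x < idx P v) &&
    [&& ~~ cell P v (idx P x) 0, ~~ side P x & cell P v (idx P x) (off P x).+2].
Proof.
move=> ex fv; have cmp : ev (e_field 1 e < e_field 1 f)%expr = (idx P x < idx P v).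
  by apply: evlt; first exact: (@ev_field 1); first exact: (@ev_field 1).
have [xv|xv] := ltnP (idx P x) (idx P v); last first.
  by apply: evM0; [exact: cmp|reflexivity|rewrite ltnNge xv].
rewrite xv in cmp.
set c0 := cell P v (idx P x) 0; set c := cell P v (idx P x) _.
have c0E : ev (e_cell f e #0)%expr = c0 by apply: ev_cell => //; apply: evC; lia.
have cE : ev (e_cell f e (e_field 3 e + #2))%expr = c.
  by apply: ev_cell => //; [have := off_lt x; lia|apply: ev_off].
have -> : [&& ~~ c0, ~~ side P x & c] = (c0 + side P x < c) :> nat.
  by case: (c0); case: (side P x); case: (c).
rewrite -[RHS]mul1n; apply: evM => //; last by rewrite mul1n bool_lt_word.
apply: evlt => //; apply: evD => //; first exact: (@ev_field 2).
by case: (c0); case: (side P x); lia.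
Qed.

Lemma ev_below e f x v : ev e = lab x -> ev f = lab v ->
  ev (e_below e f) = (idx P x < idx P v) && (cell P v (idx P x) 0 &&
    maj (cell P v (idx P x) 1) (side P x) (cell P v (idx P x) (off P x).+2)).
Proof.
move=> ex fv; have cmp : ev (e_field 1 e < e_field 1 f)%expr = (idx P x < idx P v).
  by apply: evlt; first exact: (@ev_field 1); first exact: (@ev_field 1).
have [xv|xv] := ltnP (idx P x) (idx P v); last first.
  by apply: evM0; [exact: cmp|reflexivity|rewrite ltnNge xv].
rewrite xv in cmp.
set c0 := cell P v (idx P x) 0; set c1 := cell P v (idx P x) 1; set c := cell P v (idx P x) _.
have c0E : ev (e_cell f e #0)%expr = c0 by apply: ev_cell => //; apply: evC; lia.
have c1E : ev (e_cell f e #1)%expr = c1 by apply: ev_cell => //; apply: evC; lia.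
have cE : ev (e_cell f e (e_field 3 e + #2))%expr = c.
  by apply: ev_cell => //; [have := off_lt x; lia|apply: ev_off].
have -> : c0 && maj c1 (side P x) c = (c0 * (c1 + side P x + c)) %/ 2 :> nat.
  by case: (c0); case: (c1); case: (side P x); case: (c).
have small : c0 * (c1 + side P x + c) < B.
  by case: (c0); case: (c1); case: (side P x); case: (c); rewrite /=; lia.
rewrite -[RHS]mul1n; apply: evM => //; last first.
  by rewrite mul1n; apply: leq_ltn_trans (leq_div _ _) small.
apply: evdiv => //; last by apply: evC; lia.
apply: evM => //; apply: evD => //; last by case: (c1); case: (side P x); case: (c); rewrite /=; lia.
apply: evD => //; first exact: (@ev_field 2).
by case: (c1); case: (side P x); rewrite /=; lia.
Qed.

Lemma ev_exception e x y : ev e = code x y -> ev (e_exception e) = error x y.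
Proof.
move=> exy; rewrite -error_bit.
have cB : code x y < B.
  by apply: leq_ltn_trans nn_lt; rewrite /code; have := lab_le x; have := lab_le y; nia.
have wwE : ev (e_w * e_w)%expr = w * w by exact: evM.
apply: ev_bit.
- by rewrite -Mtable; apply: evR; apply: evD => //; apply: evdiv.
- exact: evmod.
- exact: leq_ltn_trans (leq_mod _ _) cB.
- apply: leq_ltn_trans (ptr_lt x y); rewrite leq_add2l.
  rewrite -ltnS ltn_divLR //; apply: leq_trans (_ : w * w <= _); last by lia.
  by rewrite ltn_pmod // muln_gt0 w_gt0.
Qed.

Lemma ev_query x y : R 0 = lab x -> R 1 = lab y -> ev e_query = r x y.
Proof.
move=> R0 R1; rewrite /e_query /e_answer.
have lx := lab_le x; have ly := lab_le y.
have aE : ev (EArg 0) = lab x by rewrite -R0; apply: evA; lia.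
have bE : ev (EArg 1) = lab y by rewrite -R1; apply: evA; lia.
have -> : r x y = ((cls x == cls y) || decode P x y) (+) error x y.
  by rewrite /error addKb.
apply: evxor => //; last first.
  apply: ev_exception; apply: evD => //; first by apply: evM => //; nia.
  by nia.
apply: evor => //.
  by apply: eveq; [exact: (@ev_field 0)|exact: (@ev_field 0)|].
have -> : decode P x y = (idx P x < idx P y) &&
    [&& ~~ cell P y (idx P x) 0, ~~ side P x & cell P y (idx P x) (off P x).+2]
  || (idx P y < idx P x) && (cell P x (idx P y) 0 &&
    maj (cell P x (idx P y) 1) (side P y) (cell P x (idx P y) (off P y).+2)).
  by rewrite /decode; case: ltngtP; rewrite //= orbF.
by apply: evor => //; [apply: ev_above|apply: ev_below].
Qed.

End Query.

(** * The memory image *)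

Fixpoint word_of_bits (w : nat) (f : nat -> bool) : nat :=
  if w is w'.+1 then word_of_bits w' f + f w' * 2 ^ w' else 0.

Lemma word_of_bits_lt w f : word_of_bits w f < 2 ^ w.
Proof.
by elim: w => //= w IHw; rewrite expnS; case: (f w); rewrite ?mul1n ?mul0n; lia.
Qed.

Lemma bit_of_word w f i : i < w -> (word_of_bits w f %/ 2 ^ i) %% 2 = f i.
Proof.
elim: w => //= w IHw; rewrite ltnS leq_eqVlt => /orP[/eqP->|iw].
  rewrite addnC divnMDl ?expn_gt0 // divn_small ?word_of_bits_lt //.
  by rewrite addn0; case: (f w).
have -> : 2 ^ w = 2 ^ (w - i.+1) * 2 * 2 ^ i.
  by rewrite -mulnA -expnS -expnD subnK.
by rewrite addnC mulnA divnMDl ?expn_gt0 // mulnA modnMDl IHw.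
Qed.

Definition pack (w : nat) (f : nat -> bool) (len : nat) : seq nat :=
  mkseq (fun k => word_of_bits w (fun i => f (k * w + i))) len.

Lemma pack_bit w f len i : 0 < w -> i %/ w < len ->
  (nth 0 (pack w f len) (i %/ w) %/ 2 ^ (i %% w)) %% 2 = f i.
Proof.
move=> w0 il; rewrite nth_mkseq // bit_of_word ?ltn_pmod //.
by rewrite -divn_eq.
Qed.

Lemma pack_words w f len : all (fun v => v < 2 ^ w) (pack w f len).
Proof. by apply/allP => v /mapP[k _ ->]; apply: word_of_bits_lt. Qed.

Definition segment_start (sizes : seq nat) (k : nat) : nat := sumn (take k sizes).

Lemma nth_segment (ss : seq (seq nat)) k j :
  j < size (nth [::] ss k) ->
  nth 0 (flatten ss) (segment_start (shape ss) k + j) = nth 0 (nth [::] ss k) j.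
Proof.
rewrite /segment_start; elim: ss k => [|s ss IHs] [|k] //= jk; rewrite nth_cat.
  by rewrite jk.
by rewrite -addnA ltnNge leq_addr /= addKn IHs.
Qed.

Lemma segment_end (sizes : seq nat) k :
  segment_start sizes k + nth 0 sizes k <= sumn sizes.
Proof.
rewrite /segment_start; elim: sizes k => [|s ss IHs] [|k] //=; first by rewrite leq_addr.
by rewrite -addnA leq_add2l.
Qed.

Lemma nth_drop4 T (x0 a b c d : T) s k : nth x0 ([:: a; b; c; d] ++ s) (4 + k) = nth x0 s k.
Proof. by []. Qed.

Lemma sumn_mkseq f N : sumn (mkseq f N) = \sum_(i < N) f i.
Proof. by rewrite sumnE big_map -{1}[N]subn0 -/(index_iota 0 N) big_mkord. Qed.

Lemma sumn_cons4 a b c d s : sumn ([:: a; b; c; d] ++ s) = a + b + c + d + sumn s.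
Proof. by rewrite sumn_cat /= addn0 !addnA. Qed.

Lemma shape_cons4 (a b c d : seq nat) s :
  shape ([:: a; b; c; d] ++ s) = [:: size a; size b; size c; size d] ++ shape s.
Proof. by []. Qed.

(** * Layout of the memory segments *)

Section Construction.
Variables (S : finType) (lab : S -> nat) (r : rel S) (P : peeling S) (cls : S -> nat).
Variables (w n q : nat).
Local Notation B := (2 ^ w).
Local Notation err := (error r P cls).
Local Notation cde := (code lab n).

Definition row_length x := ((idx P x * q.+2) %/ w).+1.
Definition block_count := (n.+1 * n.+1 %/ (w * w)).+1.
Definition error_set : {set S * S} := [set p | err p.1 p.2].
(** A bound on the number of words in which the errors stand in for the nonempty blocks. *)
Definition total_size : nat :=
  4 + n.+1 * 5 + block_count + w + \sum_x row_length x + #|error_set| * w.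

Definition nonempty_block b := [exists p in error_set, cde p.1 p.2 %/ (w * w) == b].

(* Segment 3 is the zero block shared by all [w * w]-bit blocks without errors.
   Sizes come first because the records and the block table store addresses. *)
Definition sizes : seq nat :=
  [:: 4; n.+1 * 5; block_count; w] ++ [seq row_length x | x <- enum S]
    ++ mkseq (fun b => nonempty_block b * w) block_count.

Definition row_start x := segment_start sizes (4 + index x (enum S)).
(** Four fixed segments and [#|S|] rows precede the blocks. An empty block keeps a segment of length
    0, so that numbering stays uniform, but points to segment 3. *)
Definition block_start b :=
  segment_start sizes (if nonempty_block b then 4 + #|S| + b else 3).

Definition record_word z :=
  if [pick x | lab x == z %/ 5] is Some x then field P cls row_start x (z %% 5) else 0.
Definition row_bits x i := cell P x (i %/ q.+2) (i %% q.+2).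
Definition error_bits c := [exists p in error_set, cde p.1 p.2 == c].

Definition segments : seq (seq nat) :=
  [:: [:: w; q.+2; n.+1; segment_start sizes 2]; mkseq record_word (n.+1 * 5);
      mkseq block_start block_count; nseq w 0]
  ++ [seq pack w (row_bits x) (row_length x) | x <- enum S]
  ++ mkseq (fun b => if nonempty_block b
                     then pack w (fun i => error_bits (b * (w * w) + i)) w else [::])
       block_count.

Definition memory := flatten segments.

Hypotheses (lab_inj : injective lab) (lab_le : forall x, lab x <= n).
Hypotheses (w2 : 2 < w) (ww : w * w < B) (nn_lt : n.+1 * n.+1 < B).
Hypotheses (off_lt : forall x, off P x < q).
Hypothesis width_lt : forall x, (idx P x).+1 * q.+2 < B.
Hypothesis q_lt : q.+2 < B.
Hypothesis cls_lt : forall x, cls x < B.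
Hypothesis total_lt : total_size < B.

Let w0 : 0 < w. Proof. lia. Qed.

Lemma shape_segments : shape segments = sizes.
Proof.
rewrite /segments /sizes shape_cons4 !size_mkseq size_nseq /shape map_cat -!map_comp.
congr (_ ++ (_ ++ _)); first by apply: eq_map => x; apply: size_mkseq.
by apply: eq_map => b /=; case: ifP => _; rewrite ?size_mkseq ?mul1n.
Qed.

Lemma code_lt x y : cde x y < n.+1 * n.+1.
Proof. by rewrite /code; have := lab_le x; have := lab_le y; nia. Qed.

Lemma code_block_lt x y : cde x y %/ (w * w) < block_count.
Proof. by rewrite ltnS leq_div2r // ltnW ?code_lt. Qed.

Lemma code_inj x y x' y' : cde x y = cde x' y' -> (x, y) = (x', y').
Proof.
have dv u v : cde u v %/ n.+1 = lab u.
  by rewrite /code divnMDl // divn_small ?addn0 // ltnS.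
have md u v : cde u v %% n.+1 = lab v by rewrite /code modnMDl modn_small // ltnS.
move=> h.
have -> : x = x' by apply: lab_inj; rewrite -(dv x y) h dv.
by have -> : y = y' by apply: lab_inj; rewrite -(md x y) h md.
Qed.

Lemma sumn_nonempty : \sum_(b < block_count) nonempty_block b <= #|error_set|.
Proof.
rewrite -sum1_card.
apply: (@leq_trans (\sum_(b < block_count) \sum_(p in error_set)
                      (cde p.1 p.2 %/ (w * w) == b))).
  apply: leq_sum => b _; rewrite /nonempty_block.
  case: exists_inP => // -[p pE /eqP pb].
  by rewrite (bigD1 p) //= pb eqxx.
rewrite exchange_big /=; apply: leq_sum => p _.
rewrite (bigD1 (Ordinal (code_block_lt p.1 p.2))) //= eqxx big1 // => b.
by rewrite -val_eqE /= eq_sym => /negbTE->.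
Qed.

Lemma size_memory : size memory <= total_size.
Proof.
rewrite /memory size_flatten shape_segments /sizes sumn_cons4 sumn_cat sumn_mkseq.
rewrite sumnE big_map big_enum /=.
have -> : \sum_(i < block_count) nonempty_block i * w =
    (\sum_(i < block_count) nonempty_block i) * w by rewrite big_distrl.
have := leq_mul sumn_nonempty (leqnn w).
by rewrite /total_size -!addnA !leq_add2l.
Qed.

Lemma segment_end_lt k : segment_start sizes k + nth 0 sizes k < B.
Proof.
apply: leq_ltn_trans (segment_end _ _) _; apply: leq_ltn_trans total_lt.
by apply: leq_trans size_memory; rewrite /memory size_flatten shape_segments.
Qed.

Lemma segment_start_lt k : segment_start sizes k < B.
Proof. by apply: leq_ltn_trans (segment_end_lt k); apply: leq_addr. Qed.

Lemma nth_sizes_row x : nth 0 sizes (4 + index x (enum S)) = row_length x.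
Proof.
rewrite /sizes nth_drop4 nth_cat size_map index_mem mem_enum.
by rewrite (nth_map x) ?index_mem ?mem_enum // nth_index ?mem_enum.
Qed.

Lemma nth_segments_row x :
  nth [::] segments (4 + index x (enum S)) = pack w (row_bits x) (row_length x).
Proof.
rewrite /segments nth_drop4 nth_cat size_map index_mem mem_enum.
by rewrite (nth_map x) ?index_mem ?mem_enum // nth_index ?mem_enum.
Qed.

Lemma nth_sizes_block b : b < block_count ->
  nth 0 sizes (4 + #|S| + b) = nonempty_block b * w.
Proof.
move=> bb; rewrite /sizes -addnA nth_drop4 nth_cat size_map -cardE ltnNge leq_addr addKn.
by rewrite nth_mkseq.
Qed.

Lemma nth_segments_block b : b < block_count -> nonempty_block b ->
  nth [::] segments (4 + #|S| + b)
  = pack w (fun i => error_bits (b * (w * w) + i)) w.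
Proof.
move=> bb nb; rewrite /segments -addnA nth_drop4 nth_cat size_map -cardE ltnNge leq_addr addKn.
by rewrite nth_mkseq // nb.
Qed.

Lemma nth_segments1 : nth [::] segments 1 = mkseq record_word (n.+1 * 5).
Proof. by []. Qed.

Lemma nth_segments2 : nth [::] segments 2 = mkseq block_start block_count.
Proof. by []. Qed.

Lemma nth_segments3 : nth [::] segments 3 = nseq w 0.
Proof. by []. Qed.

Lemma nth_memory k j : j < size (nth [::] segments k) ->
  nth 0 memory (segment_start sizes k + j) = nth 0 (nth [::] segments k) j.
Proof. by move=> h; rewrite -shape_segments nth_segment. Qed.

Lemma memory_words : is_memory_image w memory.
Proof.
have B3 : 3 < B by have := segment_end_lt 0; rewrite /= ; lia.
have nB : n.+1 < B by apply: leq_ltn_trans nn_lt; nia.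
rewrite /is_memory_image; apply/allP => v /flattenP[s sS vs]; move: v vs; apply/allP.
move: sS; rewrite /segments mem_cat => /orP[|]; last first.
  rewrite mem_cat => /orP[/mapP[x _ ->]|/mapP[b _ ->]]; first exact: pack_words.
  by case: ifP => _ //; apply: pack_words.
rewrite !inE => /or4P[] /eqP->.
- rewrite /= q_lt nB segment_start_lt !andbT; have := segment_end_lt 3; rewrite /=; lia.
- apply/allP => v /mapP[z _ ->]; rewrite /record_word; case: pickP => [x _|_]; last by lia.
  have : z %% 5 < 5 by rewrite ltn_pmod.
  have wl := width_lt x.
  case: (z %% 5) => [|[|[|[|[|//]]]]] _ /=; rewrite ?cls_lt ?segment_start_lt //.
  + by apply: leq_ltn_trans wl; rewrite -[leqLHS]muln1 leq_mul.
  + exact: bool_lt_word.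
  + by apply: leq_ltn_trans (ltnW (off_lt x)) _; lia.
- by apply/allP => v /mapP[z _ ->]; apply: segment_start_lt.
- by apply/allP => v /nseqP[-> _]; lia.
Qed.

Lemma memory_answers :
  answers w (expr_program e_query) (expr_time e_query) memory lab r.
Proof.
have lab_lt x : lab x < B.
  by apply: leq_ltn_trans nn_lt; have := lab_le x; nia.
move=> a b; rewrite query_expr //; congr Some.
(* Header and records fit below [B]; this is the bound [n * 5 + 9 < B] asked for by the query. *)
have B1 : 1 * 4 + n.+1 * 5 < B by have := segment_end_lt 1; rewrite /= /segment_start /=; lia.
apply: (@ev_query S lab r P cls w n q (segment_start sizes 2) row_start block_start) => //.
- move=> k; have [kD|kD] := ltnP k (size memory); last by rewrite nth_default ?expn_gt0.
  by apply: (allP memory_words); apply: mem_nth.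
- lia.
- move=> x k k5; have -> : lab x * 5 + (4 + k) = segment_start sizes 1 + (lab x * 5 + k).
    by rewrite /segment_start /=; lia.
  have zb : lab x * 5 + k < n.+1 * 5 by have := lab_le x; lia.
  rewrite nth_memory nth_segments1 ?size_mkseq // nth_mkseq // /record_word divnMDl // modnMDl.
  rewrite divn_small // modn_small // addn0.
  case: pickP => [y /eqP/lab_inj->//|/(_ x)]; by rewrite eqxx.
- move=> v; apply: leq_ltn_trans (segment_end_lt (4 + index v (enum S))).
  by rewrite nth_sizes_row leq_add2l.
- move=> v j k jv kq; rewrite /bit_at nth_memory nth_segments_row.
    rewrite pack_bit // ?/row_bits.
      by rewrite divnMDl // modnMDl divn_small // modn_small // addn0.
    rewrite ltnS leq_div2r //; apply: (@leq_trans (j.+1 * q.+2)); first by lia.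
    by rewrite leq_mul.
  rewrite size_mkseq ltnS leq_div2r //; apply: (@leq_trans (j.+1 * q.+2)); first by lia.
  by rewrite leq_mul.
- move=> x y; apply: leq_ltn_trans (segment_end_lt 2); rewrite leq_add2l /=.
  by rewrite ltnW ?code_block_lt.
- move=> x y; rewrite nth_memory nth_segments2 ?size_mkseq ?code_block_lt //.
  by rewrite nth_mkseq ?code_block_lt.
- move=> x y; rewrite /block_start; case: ifP => [nb|_].
    apply: leq_ltn_trans (segment_end_lt (4 + #|S| + cde x y %/ (w * w))).
    by rewrite nth_sizes_block ?code_block_lt // nb mul1n.
  exact: (leq_ltn_trans _ (segment_end_lt 3)).
- move=> x y; have cb := code_block_lt x y.
  have mw : (cde x y %% (w * w)) %/ w < w.
    by rewrite ltn_divLR // ltn_pmod // muln_gt0 w0.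
  rewrite /bit_at /block_start; case: ifP => nb.
    rewrite nth_memory nth_segments_block // ?size_mkseq // pack_bit // -divn_eq.
    rewrite /error_bits; congr nat_of_bool; apply/idP/idP => [/exists_inP[[x' y']]|exy].
      by rewrite inE /= => h /eqP/code_inj[<- <-].
    by apply/exists_inP; exists (x, y); rewrite ?inE /=.
  (* The shared zero block reads 0, and an error here would make the block nonempty. *)
  rewrite nth_memory nth_segments3 ?size_nseq // nth_nseq mw div0n mod0n.
  case exy: (err x y) => //; move: nb => /negbT/negP[]; rewrite /nonempty_block; apply/exists_inP.
  by exists (x, y); rewrite ?inE /=.
- exact: modn_small.
- exact: modn_small.
Qed.

End Construction.

(** * Space *)

Lemma lg_bounds n : 1 < n -> [/\ 0 < lg n, n <= 2 ^ lg n & 2 ^ lg n <= 2 * n].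
Proof.
move=> n2; have /andP[lo hi] := @up_log_bounds 2 n isT n2.
have g0 : 0 < lg n by rewrite /lg lt0n; apply: contraTneq hi => ->; rewrite -ltnNge.
split=> //; rewrite -[in leqLHS](prednK g0) expnS; have := ltnW lo; rewrite /lg; lia.
Qed.

Lemma lglg_bounds n : 1 < n ->
  [/\ 0 < lglg n, lg n <= 2 ^ lglg n & 2 ^ lglg n <= 2 * lg n].
Proof.
move=> n2; have [g0 _ _] := lg_bounds n2; rewrite /lglg.
(* Here the clamp in [lglg] acts and gives the value 1. *)
have [g1|g1] := leqP (lg n) 1.
  have -> : lg n = 1 by lia.
  by have -> : lg 1 = 0 by [].
have [h0 lo hi] := lg_bounds g1; have -> : maxn 1 (lg (lg n)) = lg (lg n) by lia.
by split.
Qed.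

Lemma sqr_le_exp g : g * g <= 2 * 2 ^ g.
Proof.
elim: g => // g IHg; rewrite expnS.
have [g3|g3] := leqP g 2; first by case: g g3 {IHg} => [|[|[|]]].
by nia.
Qed.

(** The factor 20 makes half a word, at least [10 * g] bits, large enough to hold [w] and
    [64 * n ^ 2] separately. *)
Lemma word_room g n w : 0 < g -> 1 < n -> n <= 2 ^ g -> 20 * g <= w ->
  64 * n ^ 2 * w < 2 ^ w /\ w * w < 2 ^ w.
Proof.
move=> g0 n2 ng gw; pose h := w %/ 2.
have hw : h * 2 <= w < h * 2 + 2.
  by have := divn_eq w 2; have := ltn_pmod w (isT : 0 < 2); rewrite -/h; lia.
have w_lt : w < 2 ^ h.
  apply: (@leq_trans (h * 2 + 2)); first by lia.
  have h3 : 10 <= h by lia.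
  by rewrite -(subnK h3); elim: (h - 10) => // k IHk; rewrite addSn expnS; lia.
have n64 : 64 * n ^ 2 <= 2 ^ h.
  apply: (@leq_trans (2 ^ (8 * g))); last by rewrite leq_exp2l //; lia.
  apply: (@leq_trans (2 ^ (6 * g) * 2 ^ (2 * g))).
    apply: leq_mul; first by rewrite (_ : 64 = 2 ^ 6) // leq_exp2l //; lia.
    by rewrite [2 * g]mulnC expnM leq_exp2r.
  by rewrite -expnD leq_exp2l //; lia.
have hh : 2 ^ h * 2 ^ h <= 2 ^ w by rewrite -expnD leq_exp2l //; lia.
by split; nia.
Qed.

(** Header, records, rounding of rows and zero block take [O (n * lg n)] bits, the block table
    [O (n ^ 2 / lg n)]. The former is absorbed because [lg n ^ 2 <= 4 * n]. *)
Lemma lower_order_le n w K : 1 < n -> 20 * lg n <= w -> w <= K * lg n ->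
  4 * lg n * (w * (11 * n + 1 + w) + w * (n.+1 * n.+1 %/ (w * w))) <=
  (192 * K + 16 * K ^ 2 + 16) * n ^ 2.
Proof.
move=> n2 wlo; set g := lg n => whi.
have [g0 ng gn] := lg_bounds n2; rewrite -/g in g0 ng gn.
have gg : g * g <= 4 * n by have := sqr_le_exp g; lia.
have g_le : g <= n by rewrite /g /lg up_log_min // ltnW // ltn_expl.
have a1 : 4 * g * (w * (11 * n + 1)) <= 192 * K * n ^ 2.
  apply: (@leq_trans (4 * g * (K * g * (12 * n)))); first by rewrite !leq_mul //; lia.
  have := leq_mul gg (leqnn (48 * K * n)); rewrite -mulnn; lia.
have a2 : 4 * g * (w * w) <= 16 * K ^ 2 * n ^ 2.
  apply: (@leq_trans (4 * g * (K * g * (K * g)))); first by rewrite !leq_mul.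
  have := leq_mul (leq_mul gg g_le) (leqnn (4 * K * K)); rewrite -!mulnn; lia.
have a3 : 4 * g * (w * (n.+1 * n.+1 %/ (w * w))) <= 16 * n ^ 2.
  have gw : g <= w by lia.
  have nn : n.+1 * n.+1 <= 4 * n ^ 2 by rewrite -mulnn; nia.
  have tr4 := leq_trans (leq_trunc_div (n.+1 * n.+1) (w * w)) nn.
  move: tr4; set X := _ %/ _ => tr4.
  have := leq_mul gw (leqnn (4 * w * X)); lia.
lia.
Qed.

Section Space.
Variables (S : finType) (n w : nat) (lab : S -> nat) (r : rel S).
Hypotheses (n2 : 1 < n) (wlo : 20 * lg n <= w).
Hypotheses (cS : #|S| = n) (labS : is_labelling n lab).
Variables (P : peeling S) (q : nat).
Hypotheses (qn : q <= n) (oP : forall x, off P x < q).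
Hypothesis sP : 4 * q * (\sum_x idx P x) <= n ^ 2.

Let s := \sum_x idx P x.
Let E := #|errors r P|.

Let cls x := lab (class_rep r x).

Lemma card_error_set : #|error_set r P cls| = E.
Proof.
apply: eq_card => p; rewrite !inE /error (inj_eq (proj1 labS)).
by case: (_ || _); case: (r _ _).
Qed.

Lemma sum_row_length :
  w * (\sum_x row_length P w q x) <= q.+2 * s + w * n.
Proof.
rewrite -cS -sum1_card !big_distrr -big_split /=; apply: leq_sum => x _.
by rewrite /row_length mulnS muln1 addnC [q.+2 * _]mulnC leq_add // mulnC leq_trunc_div.
Qed.

(** The fixed parts and one rounding word per row make [6 * n + 10 + w] words, and
    [6 * n + 10 <= 11 * n + 1] for [n >= 2]. *)
Lemma space_le : w * total_size r P cls w n q <=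
  q.+2 * s + w * (11 * n + 1 + w) + w * (n.+1 * n.+1 %/ (w * w)) + E * (w * w).
Proof.
rewrite /total_size card_error_set /block_count; have := sum_row_length; nia.
Qed.

Lemma structure_exists : exists D : seq nat, [/\ is_memory_image w D,
  space_in_bits w D <=
    q.+2 * s + w * (11 * n + 1 + w) + w * (n.+1 * n.+1 %/ (w * w)) + E * (w * w)
  & answers w (expr_program e_query) (expr_time e_query) D lab r].
Proof.
have [g0 ng _] := lg_bounds n2; have [room ww] := word_room g0 n2 ng wlo.
have [lab_inj lab_le] := labS.
have {}lab_le x : lab x <= n by have /andP[] := lab_le x.
have w20 : 20 <= w by lia.
have S0 : 0 < #|S| by lia.
have q0 : 0 < q by have /card_gt0P[x _] := S0; apply: leq_ltn_trans (oP x).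
have n4 : 2 * n <= n ^ 2 by rewrite -mulnn leq_mul.
have nw : 64 * n ^ 2 * 20 <= 64 * n ^ 2 * w by rewrite leq_mul.
(* Since [q] is positive, [q.+2 <= 4 * q]. *)
have idx_le x : idx P x * q.+2 <= n ^ 2.
  apply: leq_trans sP; rewrite (bigD1 x) //=; nia.
have sq : q.+2 * s <= n ^ 2 by apply: leq_trans sP; rewrite -/s; nia.
have nn : n.+1 * n.+1 <= 4 * n ^ 2 by rewrite -mulnn; nia.
have E_le : E <= n ^ 2 by rewrite /E -cS -mulnn -card_prod max_card.
have total_lt : total_size r P cls w n q < 2 ^ w.
  apply: leq_ltn_trans room.
  have h1 : \sum_x row_length P w q x <= n ^ 2 + n.
    apply: (@leq_trans (q.+2 * s + n)); last by rewrite leq_add2r.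
    rewrite -cS -sum1_card big_distrr -big_split /=; apply: leq_sum => x _.
    by rewrite /row_length addn1 ltnS mulnC leq_div.
  have h2 : block_count w n <= n.+1 * n.+1 + 1 by rewrite /block_count addn1 ltnS leq_div.
  have h3 : E * w <= n ^ 2 * w by rewrite leq_mul.
  rewrite /total_size card_error_set; nia.
exists (memory lab r P cls w n q).
have hyps : [/\ 2 < w, n.+1 * n.+1 < 2 ^ w, forall x, (idx P x).+1 * q.+2 < 2 ^ w,
    q.+2 < 2 ^ w & forall x, cls x < 2 ^ w].
  split; [lia|lia| |lia|].
    by move=> x; have := idx_le x; rewrite mulSn; lia.
  by move=> x; have := lab_le (class_rep r x); rewrite /cls; lia.
case: hyps => h1 h2 h3 h4 h5.
split.
- exact: memory_words.
- apply: leq_trans space_le; rewrite /space_in_bits leq_mul //.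
  exact: size_memory.
- exact: memory_answers.
Qed.

End Space.

(** * Choice of the parameters *)

Lemma lg_small g la : 2 ^ la <= 2 * g -> g < 30 * la -> g <= 300.
Proof.
move=> lo hi; have [|la10] := leqP la 10; first by lia.
have : 60 * la <= 2 ^ la.
  rewrite -(subnK la10); elim: (la - 11) => // k IHk.
  by rewrite addSn expnS; lia.
lia.
Qed.

(** With these [q] and [L], the power [(4 * L) ^ q] is at most [2 ^ (g / 2)], about the square root
    of [n]. The other factors are at most [2 ^ (10 * la + 5)], which the assumption [30 * la <= g]
    fits into the other half. *)
Lemma biclique_size_le g la n q L : 0 < la -> 30 * la <= g -> g <= 2 ^ la ->
  2 ^ g <= 2 * n -> q = g %/ (10 * la) ->
  L = 2 ^ (3 * la) ->
  2 * L ^ 2 * (4 * L * q + 2 * L * (4 * L) ^ q * q) <= n.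
Proof.
move=> la0 gla gexp gn qE LE.
have qg : 10 * la * q <= g by rewrite qE mulnC leq_trunc_div.
have L4 : 4 * L <= 2 ^ (5 * la).
  by rewrite LE -[4]/(2 ^ 2) -expnD leq_exp2l //; lia.
have Lq : (4 * L) ^ q <= 2 ^ (g %/ 2).
  apply: (@leq_trans ((2 ^ (5 * la)) ^ q)); first by case: (q) => // k; rewrite leq_exp2r.
  by rewrite -expnM leq_exp2l // leq_divRL //; lia.
have q_le : q <= 2 ^ la by apply: leq_trans gexp; nia.
have L0 : 0 < L by rewrite LE expn_gt0.
have X0 : 0 < (4 * L) ^ q by rewrite expn_gt0; lia.
have step : 4 * L * q + 2 * L * (4 * L) ^ q * q <= 6 * L * q * (4 * L) ^ q by nia.
rewrite -(@leq_pmul2l 2) //; apply: leq_trans gn.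
apply: (@leq_trans (2 ^ 5 * 2 ^ (9 * la) * 2 ^ la * 2 ^ (g %/ 2))); last first.
  rewrite -!expnD leq_exp2l //; have := leq_trunc_div g 2; lia.
have -> : 2 ^ (9 * la) = L ^ 3 by rewrite LE -expnM; congr (_ ^ _); lia.
apply: (@leq_trans (2 * (2 * L ^ 2 * (6 * L * q * (4 * L) ^ q)))).
  by rewrite !leq_mul2l step !orbT.
apply: (@leq_trans (2 ^ 5 * L ^ 3 * q * (4 * L) ^ q)).
  by rewrite expnSr; set Y := (4 * L) ^ q; nia.
by rewrite !leq_mul.
Qed.

(** Slices of [t = n %/ L] heights give at most [2 * L] levels. The 5 is 1 for ordered pairs, 1 for
    the thresholds of all merges and 3 for bicliques, slices and loops. *)
Lemma error_budget n q L Y : 0 < L -> 0 < q -> q <= Y -> 2 * L ^ 2 * Y <= n ->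
  [/\ L <= n, q <= n & forall e,
    L * e <= n ^ 2 + L * (n %/ (n %/ L) * (n * Y) + n * (2 * q + n %/ L + 1)) ->
    L * e <= 5 * n ^ 2].
Proof.
rewrite -!mulnn => L0 q0 qY key.
have Lq2 : 2 * (L * q) <= n.
  by apply: leq_trans key; rewrite -mulnA leq_mul // leq_mul // leq_pmull.
have Lq : L * q <= n by lia.
have Ln : L <= n by apply: leq_trans Lq; rewrite leq_pmulr.
have qn : q <= n by apply: leq_trans Lq; rewrite leq_pmull.
split=> // e he; apply: leq_trans he _.
have tL : L * (n %/ L) <= n by rewrite mulnC leq_trunc_div.
have := ltn_ceil n L0; have : 0 < n %/ L by rewrite divn_gt0.
move: (n %/ L) tL => t tL t0 nt.
have m_le : n %/ t <= 2 * L.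
  have t2 : t.+1 <= 2 * t by lia.
  by rewrite -ltnS ltn_divLR //; have := leq_mul t2 (leqnn L); lia.
have b1 : L * (n %/ t * (n * Y)) <= n * n.
  apply: (@leq_trans (L * (2 * L * (n * Y)))); first by rewrite !leq_mul.
  have := leq_mul key (leqnn n); lia.
have h : L * (2 * q + t + 1) <= 3 * n by lia.
have := leq_mul h (leqnn n); lia.
Qed.

(** The factor [300 ^ 3] serves the case [lg n < 30 * lglg n], where [lg n <= 300] and all pairs may
    be errors. *)
Definition space_constant K := 256 * (K + 1) ^ 2 * 300 ^ 3.

Lemma space_constant_gt0 K : 0 < space_constant K.
Proof.
have pos a b c : 0 < a -> 0 < b -> 0 < c -> 0 < a * b * c.
  by rewrite !muln_gt0 => -> -> ->.
by apply: pos; rewrite // expn_gt0 ?addn1.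
Qed.

Section Bits.
Variables (S : finType) (n w K : nat) (lab : S -> nat) (r : rel S).
Hypotheses (n2 : 1 < n) (wlo : 20 * lg n <= w) (whi : w <= K * lg n).
Hypotheses (cS : #|S| = n) (labS : is_labelling n lab) (tr : transitive r).

Lemma bits_exists : exists D : seq nat, [/\ is_memory_image w D,
  4 * lg n * space_in_bits w D <= lg n * n ^ 2 + space_constant K * n ^ 2 * lglg n
  & answers w (expr_program e_query) (expr_time e_query) D lab r].
Proof.
have [g0 ng gn] := lg_bounds n2; have [la0 gla lag] := lglg_bounds n2.
have low := lower_order_le n2 wlo whi.
have g_le : lg n <= n by rewrite /lg up_log_min // ltnW // ltn_expl.
rewrite /space_constant.
have : forall g, g <= 300 -> g ^ 3 <= 300 ^ 3 by move=> g; rewrite leq_exp2r.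
have : 0 < 300 ^ 3 by rewrite expn_gt0.
move: (300 ^ 3) => G G1 G300.
have w2 : w * w <= K * lg n * (K * lg n) by rewrite leq_mul.
(* The space computation shared by both regimes. [lg n ^ 3] absorbs the [w * w] bits per error and
   the factor [lg n] of the claim. *)
have bound (P : peeling S) q : q <= n -> (forall x, off P x < q) ->
    4 * q * (\sum_x idx P x) <= n ^ 2 ->
    8 * lg n * (\sum_x idx P x) <= 40 * lglg n * n ^ 2 ->
    lg n ^ 3 * #|errors r P| <= 5 * G * n ^ 2 ->
    exists D : seq nat, [/\ is_memory_image w D,
      4 * lg n * space_in_bits w D
        <= lg n * n ^ 2 + 256 * (K + 1) ^ 2 * G * n ^ 2 * lglg n
      & answers w (expr_program e_query) (expr_time e_query) D lab r].
  move=> qn oP sP sP' eP.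
  have [D [Dw Ds Da]] := structure_exists r n2 wlo cS labS qn oP sP.
  exists D; split=> //; apply: leq_trans (leq_mul (leqnn (4 * lg n)) Ds) _.
  (* The offset cells, [q] per group, give the main term [n ^ 2 / 4]; the two flag bits fall into
     the lower-order term. *)
  have a1 : 4 * lg n * (q.+2 * \sum_x idx P x) <= lg n * n ^ 2 + 40 * lglg n * n ^ 2.
    have := leq_mul (leqnn (lg n)) sP; lia.
  have a2 : 4 * lg n * (#|errors r P| * (w * w)) <= 20 * K ^ 2 * G * n ^ 2.
    apply: (@leq_trans (4 * lg n * (#|errors r P| * (K * lg n * (K * lg n))))).
      by rewrite !leq_mul.
    have := leq_mul (leqnn (4 * K ^ 2)) eP; rewrite -mulnn expnSr -mulnn; lia.
  have GN : n ^ 2 <= G * n ^ 2 * lglg n by rewrite mulnAC leq_pmull // muln_gt0 G1.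
  have NL : lglg n * n ^ 2 <= G * n ^ 2 * lglg n by rewrite mulnAC -mulnA leq_pmull.
  have GL : G * n ^ 2 <= G * n ^ 2 * lglg n by rewrite leq_pmulr.
  move: a1 a2 low GN NL GL; set N := n ^ 2; set X := G * N * lglg n => a1 a2 a3 GN NL GL.
  have c1 := leq_mul (leqnn (192 * K + 16 * K ^ 2 + 16)) GN.
  have c2 := leq_mul (leqnn (20 * K ^ 2)) GL.
  have -> : 256 * (K + 1) ^ 2 * G * N * lglg n
      = 256 * K ^ 2 * X + 512 * K * X + 256 * X by rewrite /X -mulnn; lia.
  lia.
have [large|small] := leqP (30 * lglg n) (lg n); last first.
  apply: (bound (trivial_peeling S) 1) => //; first lia.
  - by rewrite big1.
  - by rewrite big1 // muln0.
  - have g300 := lg_small lag small.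
    apply: leq_mul; first by rewrite -[leqLHS]mul1n leq_mul // G300.
    by rewrite -cS -mulnn -card_prod max_card.
have la10 : 0 < 10 * lglg n by lia.
have [q qE] : exists q, q = lg n %/ (10 * lglg n) by eexists.
have [L LE] : exists L, L = 2 ^ (3 * lglg n) by eexists.
have q0 : 0 < q by rewrite qE divn_gt0 //; lia.
(* As [q] is positive, rounding down loses at most a factor 2. *)
have g20 : lg n <= 20 * lglg n * q.
  have := ltn_ceil (lg n) la10; rewrite -qE.
  have q2 : q.+1 <= 2 * q by lia.
  have := leq_mul q2 (leqnn (10 * lglg n)); lia.
have L0 : 0 < L by rewrite LE expn_gt0.
have gL : lg n ^ 3 <= L by rewrite LE mulnC expnM leq_exp2r.
have key := biclique_size_le la0 large gla gn qE LE.
have qY : q <= 4 * L * q + 2 * L * (4 * L) ^ q * q.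
  by apply: leq_trans (leq_addr _ _); rewrite leq_pmull // muln_gt0.
have [Ln qn budget] := error_budget L0 q0 qY key.
have t0 : 0 < n %/ L by rewrite divn_gt0.
have [P [oP fP dP]] := transitive_peeling tr q0 L0 t0.
have sP := sum_idx fP; rewrite cS in dP sP.
apply: (bound P q) => //.
  have := leq_mul g20 (leqnn (8 * \sum_x idx P x)).
  have := leq_mul (leqnn (40 * lglg n)) sP.
  clear; lia.
apply: leq_trans (leq_mul gL (leqnn _)) _.
apply: leq_trans (budget _ dP) _.
by rewrite leq_mul // leq_pmulr.
Qed.

End Bits.

Import Order.TTheory GRing.Theory Num.Theory.
Local Open Scope ring_scope.

(* The model comes first: word size at least kappa * lg n (so that the memory
   is addressable) and at most K * lg n.  The constants c and t and the query
   program are then uniform in n, in the word size, and in the relation. *)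
Theorem theorem3 :
  exists kappa : nat, forall K : nat,
  exists (c : rat) (t : nat) (p : program), 0 < c /\
  forall (n w : nat), (2 <= n)%N ->
    (kappa * lg n <= w <= K * lg n)%N ->
  forall (S : finType) (lab : S -> nat) (r : rel S),
    #|S| = n -> is_labelling n lab -> transitive r ->
  exists D : seq nat,
    [/\ is_memory_image w D,
        (space_in_bits w D)%:R <=
          n%:R ^+ 2 / 4%:R + c * (n%:R ^+ 2 * (lglg n)%:R / (lg n)%:R)
      & answers w p t D lab r].
Proof.
exists 20%N => K.
(* The 4 comes from the factor [4 * lg n] in [bits_exists]. *)
exists ((space_constant K)%:R / 4%:R), (expr_time e_query), (expr_program e_query).
split.
  by rewrite divr_gt0 ?ltr0n ?space_constant_gt0.
move=> n w n2 /andP[wlo whi] S lab r cS labS tr.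
have [D [Dw Ds Da]] := bits_exists n2 wlo whi cS labS tr.
exists D; split=> //.
have [g0 _ _] := lg_bounds n2.
move: Ds; move: (space_in_bits w D) (space_constant K) => b C.
move: (lg n) (lglg n) g0 => g la g0 Ds.
have g0' : 0 < g%:R :> rat by rewrite ltr0n.
have gN0 : g%:R != 0 :> rat by rewrite gt_eqF.
have -> : n%:R ^+ 2 / 4%:R + C%:R / 4%:R * (n%:R ^+ 2 * la%:R / g%:R)
    = (g * n ^ 2 + C * n ^ 2 * la)%N%:R / (4 * g)%N%:R :> rat.
  by rewrite natrD !natrM; field.
by rewrite ler_pdivlMr ?ltr0n ?muln_gt0 ?g0 // -natrM ler_nat mulnC.
Qed.
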